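(* Let $q$ be an odd prime power with $q\equiv -1 \pmod 3$, and let $L(q)$ be the ternary code of length $2q+2$ generated by $G'=(I_{q+1},U_q)$ (notation as in the context). Then $L(q)$ contains a set of $4q+2$ codewords with all entries in $\{0,1\}$ and of Hamming weight $q+1$ which form the block-by-point incidence matrix of a Hadamard $3$-$(2q+2,q+1,(q-1)/2)$ design $D(q)$ associated with a Paley-Hadamard matrix of type II; namely, $D(q)$ is the Hadamard 3-design obtained from the Hadamard matrix \[H=\begin{pmatrix} I_{q+1}-U_q^T & U_q+I_{q+1}\\ I_{q+1}+U_q^T & U_q-I_{q+1}\end{pmatrix},\] whose first row is the all-one vector, whose rows (with $-1$ read as $2\in GF(3)$) are codewords of $L(q)$, and which is equivalent to a Paley-Hadamard matrix of type II.
   Context: All codes are over $GF(3)$; $-1$ is identified with $2$. For an odd prime power $q$ with $q\equiv -1\pmod 3$, $S_q=(s_{i,j})$ is the $(q+1)\times(q+1)$ matrix with rows and columns labeled by $\infty$ and the elements of $GF(q)$, where $s_{\infty,\infty}=0$, $s_{a,a}=0$, $s_{\infty,a}=1$ for $a\in GF(q)$, $s_{a,\infty}=1$ if $-1$ is a square in $GF(q)$ and $s_{a,\infty}=-1$ otherwise, and for $a\neq b$ in $GF(q)$, $s_{a,b}=1$ if $a-b$ is a square in $GF(q)$ and $s_{a,b}=-1$ otherwise. $U_q$ is obtained from $S_q$ by replacing every nonzero entry in the column labeled $\infty$ by $-1$. $L(q)$ is the ternary code with generator matrix $(I_{q+1},U_q)$. A Hadamard matrix of order $n$ is an $n\times n$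 $(\pm1)$-matrix $H$ with $HH^T=nI$; two Hadamard matrices $H_1,H_2$ are equivalent if $LH_1R=H_2$ for some $\{0,\pm1\}$-monomial matrices $L,R$. The Paley-Hadamard matrices of type II are $H_1(q)=\begin{pmatrix} I+S_q & -I+S_q\\ -I+S_q & -I-S_q\end{pmatrix}$ if $q\equiv 1\pmod 4$ and $H_3(q)=\begin{pmatrix} I+S_q & I+S_q\\ I-S_q & -I+S_q\end{pmatrix}$ if $q\equiv 3\pmod 4$ ($I=I_{q+1}$). If $H$ is a Hadamard matrix of order $4t$ whose first row is all-one, the Hadamard $3$-$(4t,2t,t-1)$ design obtained from $H$ has as points the $4t$ column indices and as blocks, for each row $r$ of $H$ other than the first, the two sets $\{j: r_j=1\}$ and $\{j:r_j=-1\}$ (so $8t-2$ blocks of size $2t$). *)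

(* Defs.v *)
From HB Require Import structures.
From mathcomp Require Import all_boot all_order all_algebra.

Set Implicit Arguments.
Unset Strict Implicit.
Unset Printing Implicit Defensive.

Import GRing.Theory.
Local Open Scope ring_scope.

Section PaleyMatrices.

Variable F : finFieldType.

Definition is_square (x : F) : bool := [exists y : F, y ^+ 2 == x].

(* F plays GF(q), with q = #|F|; the label infinity is None, and Some a is the
   label a in F. *)
Definition paley_entry (x y : option F) : int :=
  match x, y with
  | None, None => 0
  | None, Some _ => 1
  | Some _, None => if is_square (-1) then 1 else -1
  | Some a, Some b =>
      if a == b then 0 else if is_square (a - b) then 1 else -1
  end.

(* Index 0 carries the label infinity; the other indices follow the
   enumeration of F. *)
Definition label (i : 'I_#|F|.+1) : option F := omap enum_val (unlift ord0 i).

Definition S_mx : 'M[int]_#|F|.+1 :=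
  \matrix_(i, j) paley_entry (label i) (label j).

Definition U_mx : 'M[int]_#|F|.+1 :=
  \matrix_(i, j) if (label j == None) && (S_mx i j != 0) then -1 else S_mx i j.

Definition paley_hadamard_H1 : 'M[int]_(#|F|.+1 + #|F|.+1) :=
  block_mx (1%:M + S_mx) (- 1%:M + S_mx)
           (- 1%:M + S_mx) (- 1%:M - S_mx).

Definition paley_hadamard_H3 : 'M[int]_(#|F|.+1 + #|F|.+1) :=
  block_mx (1%:M + S_mx) (1%:M + S_mx)
           (1%:M - S_mx) (- 1%:M + S_mx).

(* For odd #|F|, the second branch is the case #|F| = 3 mod 4. *)
Definition paley_hadamard_II : 'M[int]_(#|F|.+1 + #|F|.+1) :=
  if (#|F| == 1 %[mod 4])%N then paley_hadamard_H1 else paley_hadamard_H3.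

Definition H_mx : 'M[int]_(#|F|.+1 + #|F|.+1) :=
  block_mx (1%:M - U_mx^T) (U_mx + 1%:M)
           (1%:M + U_mx^T) (U_mx - 1%:M).

End PaleyMatrices.

Definition mod3 (m n : nat) (A : 'M[int]_(m, n)) : 'M['F_3]_(m, n) :=
  map_mx (fun z : int => z%:~R) A.

Definition code_of (m n : nat) (G : 'M['F_3]_(m, n)) : {set 'rV['F_3]_n} :=
  [set c : 'rV['F_3]_n | (c <= G)%MS].

Definition L_code (F : finFieldType) : {set 'rV['F_3]_(#|F|.+1 + #|F|.+1)} :=
  code_of (row_mx 1%:M (mod3 (U_mx F))).

Definition hamming_weight (n : nat) (c : 'rV['F_3]_n) : nat :=
  #|[set j | c 0 j != 0]|.

Definition is_hadamard (n : nat) (H : 'M[int]_n) : Prop :=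
  (forall i j, (H i j == 1) || (H i j == -1)) /\ H *m H^T = (n%:R)%:M.

Definition is_monomial (n : nat) (A : 'M[int]_n) : Prop :=
  [/\ forall i j, A i j \in [:: 0; 1; -1],
      forall i, #|[set j | A i j != 0]| = 1%N
    & forall j, #|[set i | A i j != 0]| = 1%N].

Definition hadamard_equiv (n : nat) (H1 H2 : 'M[int]_n) : Prop :=
  exists L R : 'M[int]_n,
    [/\ is_monomial L, is_monomial R & L *m H1 *m R = H2].

Definition first_row_ones (n : nat) (H : 'M[int]_n) : Prop :=
  forall i j : 'I_n, i = 0%N :> nat -> H i j = 1.

(* The set of blocks; the points are the column indices.  Meant for a
   Hadamard matrix whose first row is all-one, in which case all the listed
   blocks are distinct. *)
Definition hadamard_design (n : nat) (H : 'M[int]_n) : {set {set 'I_n}} :=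
  [set [set j | H i j == 1] | i : 'I_n & (0 < i)%N] :|:
  [set [set j | H i j == -1] | i : 'I_n & (0 < i)%N].

Definition is_design (t v k lambda : nat) (T : finType) (D : {set {set T}})
    : Prop :=
  [/\ #|T| = v,
      forall B, B \in D -> #|B| = k
    & forall X : {set T}, #|X| = t -> #|[set B in D | X \subset B]| = lambda].

Definition is_incidence_matrix (b n : nat) (M : 'M['F_3]_(b, n))
    (D : {set {set 'I_n}}) : Prop :=
  exists e : 'I_b -> {set 'I_n},
    [/\ injective e, [set e i | i : 'I_b] = D
      & forall i j, M i j = (j \in e i)%:R].

(* Main.v *)
(* The quadratic character [chi] of [F] satisfies
   [\sum_x chi x * chi (x + c) = -1] for [c != 0], whence
   [S *m S^T = q], and the same for [U], on either side.  Expanding the blocks,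
   [H *m H^T = 2 q + 2].  As [U^T *m U = q = -1] modulo 3, the rows of [H] are
   [x (I, U)] with [x] a row of [I - U^T] or [I + U^T].  If [q = 3 %[mod 4]],
   then [U = S = - S^T] and [H] is literally [H_3(q)].  If [q = 1 %[mod 4]],
   then [U = S D] with [S] symmetric and [D] the sign change at infinity, and
   [H] becomes [H_1(q)] after changing signs in the second half of the columns
   and permuting the rows up to sign.  The indicator vector of a block
   [{j : h_j = s}] is [- (1 + s h)] modulo 3, so it lies in the code. *)

Require Import Defs.
From HB Require Import structures.
From mathcomp Require Import all_boot all_order all_algebra.
From mathcomp Require Import cyclic finfield ring zify.

Set Implicit Arguments.
Unset Strict Implicit.

Import GRing.Theory Num.Theory.
Local Open Scope ring_scope.

(** * Quadratic character of a finite field of odd order *)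

Section QuadraticCharacter.

Variable F : finFieldType.
Hypothesis q_odd : odd #|F|.

Definition quad_char (x : F) : int :=
  if x == 0 then 0 else if is_square x then 1 else -1.

Lemma card_gt1 : (1 < #|F|)%N.
Proof. exact: finNzRing_gt1. Qed.

Lemma expf_card_pred (x : F) : x != 0 -> x ^+ #|F|.-1 = 1.
Proof.
move=> x_neq0; have q_gt1 := card_gt1; apply: (mulfI x_neq0).
have := expf_card x; rewrite -{1}(ltn_predK q_gt1) exprS => ->.
by rewrite mulr1.
Qed.

(** The nonzero elements are [#|F|.-1] distinct roots of unity of that exponent, and in a field this
    forces a primitive one among them. *)
Lemma finField_prim_root : exists g : F, (#|F|.-1).-primitive_root g.
Proof.
have q_gt1 := card_gt1.
pose rs := enum (predC1 (0 : F)).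
have rs_size : size rs = #|F|.-1 by rewrite -cardE cardC1.
have /hasP[g _ g_prim] : has (#|F|.-1).-primitive_root rs.
  apply: has_prim_root; rewrite ?enum_uniq ?rs_size //; first by lia.
  apply/allP=> x; rewrite mem_enum /= => x_neq0.
  by rewrite unity_rootE expf_card_pred.
by exists g.
Qed.

Lemma prim_root_gen (g x : F) :
  (#|F|.-1).-primitive_root g -> x != 0 -> exists k, x = g ^+ k.
Proof.
move=> g_prim /expf_card_pred x_unity.
by have [k ->] := prim_rootP g_prim x_unity; exists k.
Qed.

Lemma prim_root_neq0 (g : F) : (#|F|.-1).-primitive_root g -> g != 0.
Proof.
move=> g_prim; have q_gt1 := card_gt1.
apply/eqP=> g0; have := prim_expr_order g_prim.
rewrite g0 expr0n; case: eqP => [|_ /eqP]; first by lia.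
by rewrite eq_sym oner_eq0.
Qed.

(** As q is odd, the order q - 1 of [g] is even, so exponents of equal powers of [g] have the same
    parity. *)
Lemma is_square_prim_root (g : F) k :
  (#|F|.-1).-primitive_root g -> is_square (g ^+ k) = ~~ odd k.
Proof.
move=> g_prim; have q_gt1 := card_gt1.
apply/existsP/idP => [[y /eqP y2]|k_even]; last first.
  by exists (g ^+ k./2); rewrite -exprM muln2 even_halfK.
have y_neq0 : y != 0.
  have := expf_neq0 k (prim_root_neq0 g_prim).
  by rewrite -y2 expf_eq0.
have [i y_def] := prim_root_gen g_prim y_neq0.
move: y2; rewrite y_def -exprM => /eqP; rewrite (eq_prim_root_expr g_prim).
move=> /eqP /(congr1 (fun m => m %% 2)%N).
by rewrite !modn_dvdm ?dvdn2 ?modn2; lia.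
Qed.

Lemma quad_char_prim_root (g : F) k :
  (#|F|.-1).-primitive_root g -> quad_char (g ^+ k) = (-1) ^+ k.
Proof.
move=> g_prim; rewrite /quad_char (negPf (expf_neq0 k (prim_root_neq0 g_prim))).
by rewrite (is_square_prim_root k g_prim) -signr_odd; case: (odd k).
Qed.

Lemma quad_char0 : quad_char 0 = 0.
Proof. by rewrite /quad_char eqxx. Qed.

Lemma quad_charM x y : quad_char (x * y) = quad_char x * quad_char y.
Proof.
have [g g_prim] := finField_prim_root.
have [->|x0] := eqVneq x 0; first by rewrite mul0r quad_char0 mul0r.
have [->|y0] := eqVneq y 0; first by rewrite mulr0 quad_char0 mulr0.
have [k ->] := prim_root_gen g_prim x0; have [l ->] := prim_root_gen g_prim y0.
by rewrite -exprD !(quad_char_prim_root _ g_prim) exprD.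
Qed.

Lemma quad_char_sqr x : quad_char x * quad_char x = (x != 0)%:R.
Proof. by rewrite /quad_char; case: (x == 0); case: (is_square x). Qed.

Lemma quad_char1 : quad_char 1 = 1.
Proof.
have [g g_prim] := finField_prim_root.
by rewrite -(expr0 g) (quad_char_prim_root _ g_prim).
Qed.

(** Multiplication by the nonsquare [g] permutes the field and negates every term, so the sum equals
    its own opposite. *)
Lemma sum_quad_char : \sum_(x : F) quad_char x = 0.
Proof.
have [g g_prim] := finField_prim_root; have g0 := prim_root_neq0 g_prim.
have: \sum_(x : F) quad_char x = - \sum_(x : F) quad_char x.
  rewrite {1}(reindex_inj (mulfI g0)) -sumrN; apply: eq_bigr => x _.
  by rewrite quad_charM -{1}(expr1 g) (quad_char_prim_root _ g_prim) mulN1r.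
by lia.
Qed.

(** For nonzero x the term is chi(x)^2 chi(1 + c/x) = chi(1 + c/x), and 1 + c/x takes every value
    except 1 once; the sum is thus 0 - chi(1). *)
Lemma sum_quad_char_shift (c : F) : c != 0 ->
  \sum_(x : F) quad_char x * quad_char (x + c) = -1.
Proof.
move=> c0; rewrite (bigD1 0) //= quad_char0 mul0r add0r.
have -> : \sum_(x : F | x != 0) quad_char x * quad_char (x + c)
    = \sum_(x : F | x != 0) quad_char (1 + c * x^-1).
  apply: eq_bigr => x x0.
  have -> : x + c = x * (1 + c * x^-1) by field.
  by rewrite quad_charM mulrA quad_char_sqr x0 mul1r.
(* Since 0^-1 = 0 by convention, inversion is a bijection of the whole field. *)
rewrite (reindex_inj invr_inj) /=.
have -> : \sum_(x : F | x^-1 != 0) quad_char (1 + c * x^-1^-1)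
   = \sum_(x : F | x != 0) quad_char (1 + c * x).
  by apply: eq_big => x; rewrite ?invr_eq0 ?invrK.
have := sum_quad_char; rewrite (reindex_inj (addrI 1)) (reindex_inj (mulfI c0)).
rewrite (bigD1 0) //= mulr0 addr0 quad_char1 => sum0.
by apply: (addrI 1); rewrite sum0 addrN.
Qed.

Lemma is_squareN1 : is_square (-1 : F) = (#|F| == 1 %[mod 4])%N.
Proof.
have [g g_prim] := finField_prim_root; have q_gt1 := card_gt1.
have <- : g ^+ #|F|./2 = -1.
  have: (g ^+ #|F|./2) ^+ 2 == 1.
    have -> : g ^+ #|F|./2 ^+ 2 = g ^+ #|F|.-1
      by rewrite -exprM; congr (_ ^+ _); lia.
    by rewrite (prim_expr_order g_prim).
  (* The value 1 is excluded: the exponent (q - 1)/2 is positive and smaller than the order q -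
     1. *)
  rewrite sqrf_eq1 => /orP[|/eqP //].
  rewrite -(prim_order_dvd g_prim) => /dvdn_leq; lia.
by rewrite (is_square_prim_root _ g_prim); lia.
Qed.

Lemma quad_charN1 : quad_char (-1) = if is_square (-1 : F) then 1 else -1.
Proof. by rewrite /quad_char oppr_eq0 oner_eq0. Qed.

(** * Labels and the orthogonality of the Paley matrix [S_mx] *)

Lemma label_ord0 : label (ord0 : 'I_#|F|.+1) = None.
Proof. by rewrite /label unlift_none. Qed.

Lemma label_eq_None (i : 'I_#|F|.+1) : (label i == None) = (i == ord0).
Proof. by rewrite /label; case: unliftP => [j|] ->. Qed.

Lemma label_inj : injective (@label F).
Proof.
move=> i j; rewrite /label.
case: unliftP => [i'|] ->; case: unliftP => [j'|] -> //= [].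
by move=> /enum_val_inj ->.
Qed.

Lemma sum_label (f : option F -> int) :
  \sum_(i < #|F|.+1) f (label i) = f None + \sum_(a : F) f (Some a).
Proof.
rewrite big_ord_recl label_ord0; congr (_ + _).
rewrite (reindex_onto enum_rank enum_val) /=; last first.
  by move=> i _; rewrite enum_valK.
rewrite (eq_bigl xpredT) => [|a]; last by rewrite enum_rankK eqxx.
by apply: eq_bigr => a _; rewrite /label liftK /= enum_rankK.
Qed.

Lemma paley_entry_Some (a b : F) :
  paley_entry (Some a) (Some b) = quad_char (a - b).
Proof. by rewrite /= /quad_char subr_eq0. Qed.

Lemma paley_entry_diag (x : option F) : paley_entry x x = 0.
Proof. by case: x => //= a; rewrite eqxx. Qed.

Lemma paley_entry_off (x y : option F) : x != y ->
  paley_entry x y = 1 \/ paley_entry x y = -1.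
Proof.
case: x y => [a|] [b|] //=; last by left.
- rewrite (inj_eq Some_inj) => /negPf ->.
  by case: (is_square (a - b)); [left | right].
- by case: (is_square (-1)); [left | right].
Qed.

(** The factor is chi(-1), from chi(b - a) = chi(-1) chi(a - b); the entries in the column of
    infinity are chosen to obey the same rule. *)
Lemma paley_entry_swap (x y : option F) :
  paley_entry y x = (if is_square (-1 : F) then 1 else -1) * paley_entry x y.
Proof.
case: x y => [a|] [b|] //=; last by rewrite mulr0.
- by rewrite -/(paley_entry (Some b) (Some a)) -/(paley_entry (Some a) (Some b))
     !paley_entry_Some -quad_charN1 -quad_charM mulN1r opprB.
- by case: (is_square (-1)).
- by rewrite mulr1.
Qed.

Lemma paley_dot_None_Some (a : F) :
  \sum_(b : F) paley_entry None (Some b) * paley_entry (Some a) (Some b) = 0.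
Proof.
under eq_bigr => b _ do rewrite paley_entry_Some mul1r.
by rewrite -[RHS]sum_quad_char [RHS](reindex_inj (subrI a)).
Qed.

(** For two distinct finite labels, infinity contributes 1 and the shifted character sum contributes
    -1; for equal finite labels the contributions are 1 and q - 1. *)
Lemma paley_dot (x y : option F) :
  paley_entry x None * paley_entry y None
    + \sum_(b : F) paley_entry x (Some b) * paley_entry y (Some b)
  = (#|F|)%:R *+ (x == y).
Proof.
case: x y => [a|] [b|]; rewrite ?mul0r ?mulr0 ?add0r; last first.
- by under eq_bigr => c _ do rewrite mul1r; rewrite sumr_const eqxx.
- exact: paley_dot_None_Some.
- by under eq_bigr => c _ do rewrite mulrC; exact: paley_dot_None_Some.
have -> : paley_entry (Some a) None * paley_entry (Some b) None = 1.
  by rewrite /=; case: (is_square (-1)).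
under eq_bigr => c _ do rewrite !paley_entry_Some.
(* Substituting a - c for c turns a - c into c and b - c into c + (b - a), the shape of the shifted
   sum. *)
rewrite (reindex_inj (subrI a)) /= (inj_eq Some_inj).
have [<-|ab] := eqVneq a b.
  under eq_bigr => c _ do rewrite subKr quad_char_sqr.
  rewrite (bigD1 0) //= eqxx add0r.
  rewrite (eq_bigr (fun=> 1)) => [|c ->] //.
  rewrite sumr_const cardC1.
  by rewrite mulr1n -[in RHS](ltn_predK card_gt1) -natr1 addrC.
under eq_bigr => c _.
  rewrite subKr (_ : b - (a - c) = c + (b - a)); last by ring.
  over.
by rewrite sum_quad_char_shift ?subr_eq0 1?eq_sym // addrN.
Qed.

Lemma S_mx_mul_tr : S_mx F *m (S_mx F)^T = (#|F|%:R)%:M.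
Proof.
apply/matrixP=> i k; rewrite !mxE.
under eq_bigr => j _ do rewrite !mxE.
rewrite (sum_label
  (fun y => paley_entry (label i) y * paley_entry (label k) y)).
by rewrite paley_dot (inj_eq label_inj).
Qed.

Lemma tr_S_mx :
  (S_mx F)^T = (if is_square (-1 : F) then 1 else -1) *: S_mx F.
Proof. by apply/matrixP=> i j; rewrite !mxE paley_entry_swap. Qed.

(** [S_mx F] commutes with its transpose, which is a scalar multiple of it. *)
Lemma S_mx_tr_mul : (S_mx F)^T *m S_mx F = (#|F|%:R)%:M.
Proof. by rewrite -S_mx_mul_tr tr_S_mx -scalemxAl -scalemxAr. Qed.

(** * The sign change at infinity and the matrix [U_mx] *)

Definition infty_proj : 'M[int]_#|F|.+1 := delta_mx ord0 ord0.

(** The diagonal matrix with -1 at infinity and 1 elsewhere, written through the projection so that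
    products expand by linearity. *)
Definition infty_flip : 'M[int]_#|F|.+1 := 1%:M - infty_proj - infty_proj.

Lemma infty_projK : infty_proj *m infty_proj = infty_proj.
Proof. by rewrite mul_delta_mx. Qed.

Lemma infty_flipK : infty_flip *m infty_flip = 1%:M.
Proof.
rewrite /infty_flip !(mulmxBl, mulmxBr, mul1mx, mulmx1) infty_projK.
by apply/matrixP=> i j; rewrite !mxE; ring.
Qed.

Lemma tr_infty_flip : infty_flip^T = infty_flip.
Proof. by rewrite /infty_flip !linearB /= trmx1 trmx_delta. Qed.

Lemma infty_flipE : infty_flip = diag_mx (\row_j if j == ord0 then -1 else 1).
Proof.
apply/matrixP=> i j; rewrite !mxE.
have [<-|ij] := eqVneq i j; first by case: eqP.
by case: eqP => // i0; case: eqP => // j0; move: ij; rewrite i0 j0 eqxx.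
Qed.

(** Here the column of infinity in [S_mx F] already consists of -1 off the diagonal. *)
Lemma U_mx_nonsquare : ~~ is_square (-1 : F) -> U_mx F = S_mx F.
Proof.
move=> /negPf nsq; apply/matrixP=> i j; rewrite !mxE.
by case: (label i) (label j) => [a|] [b|] //=; rewrite nsq.
Qed.

Lemma U_mx_square : is_square (-1 : F) -> U_mx F = S_mx F *m infty_flip.
Proof.
move=> sq; rewrite infty_flipE mul_mx_diag; apply/matrixP=> i j; rewrite !mxE.
rewrite -label_eq_None.
by case: (label i) (label j) => [a|] [b|] //=; rewrite ?sq ?mulr1 ?mul0r.
Qed.

Lemma U_mx_mul_tr : U_mx F *m (U_mx F)^T = (#|F|%:R)%:M.
Proof.
have [sq|nsq] := boolP (is_square (-1 : F)); last first.
  by rewrite U_mx_nonsquare // S_mx_mul_tr.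
rewrite U_mx_square // trmx_mul tr_infty_flip mulmxA -(mulmxA (S_mx F)).
by rewrite infty_flipK mulmx1 S_mx_mul_tr.
Qed.

Lemma U_mx_tr_mul : (U_mx F)^T *m U_mx F = (#|F|%:R)%:M.
Proof.
have [sq|nsq] := boolP (is_square (-1 : F)); last first.
  by rewrite U_mx_nonsquare // S_mx_tr_mul.
rewrite U_mx_square // trmx_mul tr_infty_flip mulmxA -(mulmxA infty_flip).
by rewrite S_mx_tr_mul mul_mx_scalar -scalemxAl infty_flipK scalemx1.
Qed.

Lemma U_mx_diag i : U_mx F i i = 0.
Proof. by rewrite !mxE paley_entry_diag eqxx andbF. Qed.

Lemma U_mx_off i j : i != j -> U_mx F i j = 1 \/ U_mx F i j = -1.
Proof.
move=> ij; rewrite !mxE; case: ifP => _; first by right.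
by apply: paley_entry_off; rewrite (inj_eq label_inj).
Qed.

Lemma U_mx_row0 j : U_mx F ord0 j = (j != ord0)%:R.
Proof.
by rewrite !mxE label_ord0 -label_eq_None; case: (label j).
Qed.

Lemma U_mx_col0 i : U_mx F i ord0 = - (i != ord0)%:R.
Proof.
rewrite !mxE label_ord0 -label_eq_None; case: (label i) => [a|] //=.
by case: (is_square (-1)).
Qed.

End QuadraticCharacter.

(** * Hadamard matrices and their 3-designs *)

Lemma cards3_decomp (T : finType) (X : {set T}) : #|X| = 3 ->
  exists x y z, [/\ x != y, x != z, y != z & X = [set x; y; z]].
Proof.
move=> X3; have /card_gt0P[x xX] : (0 < #|X|)%N by rewrite X3.
have /eqP/cards2P[y [z [yz Xx]]] : #|X :\ x| = 2.
  by move: X3; rewrite (cardsD1 x) xX => -[].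
have: x \notin X :\ x by rewrite setD11.
rewrite {1}Xx !inE negb_or => /andP[xy xz].
by exists x, y, z; split; rewrite // -(setD1K xX) Xx setUA.
Qed.

Section HadamardDesign.

Variables (n : nat) (H : 'M[int]_n).
Hypothesis H_hadamard : is_hadamard H.

Lemma hadamard_entry i j : (H i j == 1) || (H i j == -1).
Proof. by have [+ _] := H_hadamard; apply. Qed.

Lemma hadamard_entry_sqr i j : H i j * H i j = 1.
Proof. by case/orP: (hadamard_entry i j) => /eqP ->. Qed.

Lemma hadamard_dot_row i k : \sum_j H i j * H k j = n%:R *+ (i == k).
Proof.
have [_ /matrixP /(_ i k)] := H_hadamard; rewrite !mxE => <-.
by apply: eq_bigr => j _; rewrite mxE.
Qed.

(* [H *m (H^T *m H - n) = 0], and over the integers [H] can be cancelled by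
   multiplying with its adjugate since [\det H] is nonzero. *)
Lemma hadamard_dot_col j k : \sum_i H i j * H i k = n%:R *+ (j == k).
Proof.
have [_ HHt] := H_hadamard.
have n_gt0 : (0 < n)%N by apply: leq_ltn_trans (ltn_ord j).
have det_neq0 : \det H != 0.
  apply/eqP=> det0; have := congr1 determinant HHt.
  rewrite det_mulmx det0 mul0r det_scalar => /esym/eqP.
  by rewrite expf_eq0 n_gt0 pnatr_eq0 eqn0Ngt n_gt0.
have : H *m (H^T *m H - (n%:R)%:M) = 0.
  by rewrite mulmxBr mulmxA HHt mul_mx_scalar mul_scalar_mx subrr.
move/(congr1 (mulmx (\adj H))); rewrite mulmxA mul_adj_mx mulmx0 mul_scalar_mx.
move/matrixP/(_ j k)/eqP; rewrite !mxE mulf_eq0 (negPf det_neq0) /= subr_eq0.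
move=> /eqP <-; by apply: eq_bigr => i _; rewrite mxE.
Qed.

(** The bit encodes the sign, so that both families of blocks become a single injective image,
    convenient for counting. *)
Definition row_block (p : bool * 'I_n) : {set 'I_n} :=
  [set j | H p.2 j == (-1) ^+ p.1].

Lemma hadamard_designE :
  hadamard_design H = row_block @: [set p : bool * 'I_n | (0 < p.2)%N].
Proof.
apply/setP=> B; rewrite inE; apply/orP/imsetP.
  by case=> /imsetP[i]; rewrite inE => i_gt0 ->;
    [exists (false, i) | exists (true, i)]; rewrite ?inE.
case=> [[[] i]]; rewrite inE => /= i_gt0 ->; [right | left];
  by apply/imsetP; exists i; rewrite ?inE.
Qed.

Lemma row_blockE (s : bool) i j :
  H i j = (-1) ^+ s * ((j \in row_block (s, i))%:R *+ 2 - 1).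
Proof.
by rewrite inE /=; case/orP: (hadamard_entry i j) => /eqP ->; case: s.
Qed.

(** Rows sharing a block agree up to sign; distinct rows would then have inner product n or -n
    instead of 0. *)
Lemma row_block_inj : injective row_block.
Proof.
move=> [s i] [t k] blocks_eq.
have rowE j : H i j = (-1) ^+ s * (-1) ^+ t * H k j.
  rewrite (row_blockE s i j) blocks_eq (row_blockE t k j).
  by rewrite mulrA -mulrA -[_ * _ * _]mulrA signrMK.
have i_eq_k : i = k.
  apply/eqP/negPn/negP=> ik; have := hadamard_dot_row i k.
  rewrite (negPf ik); under eq_bigr => j _ do
    rewrite rowE -(mulrA _ (H k j)) hadamard_entry_sqr mulr1.
  rewrite sumr_const card_ord -signr_addb => /eqP.
  by rewrite mulrn_eq0 signr_eq0 orbF => /eqP n0;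
    case: i {rowE ik blocks_eq} => m; rewrite n0.
(* Any column would show that the signs agree; [i] serves as one. *)
subst k; congr (_, _); have := rowE i.
by case/orP: (hadamard_entry i i) => /eqP ->; case: s {rowE blocks_eq}; case: t.
Qed.

Lemma card_rows_pos : (0 < n)%N ->
  #|[set p : bool * 'I_n | (0 < p.2)%N]| = (2 * n.-1)%N.
Proof.
move=> n_gt0; pose i0 := Ordinal n_gt0.
have -> : [set p : bool * 'I_n | (0 < p.2)%N] = setX setT [set~ i0].
  by apply/setP=> -[s i]; rewrite !inE -val_eqE /= lt0n.
by rewrite cardsX cardsT card_bool cardsC1 card_ord.
Qed.

Lemma card_hadamard_design : (0 < n)%N -> #|hadamard_design H| = (2 * n.-1)%N.
Proof.
move=> n_gt0.
by rewrite hadamard_designE (card_imset _ row_block_inj) card_rows_pos.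
Qed.

Hypothesis H_first_row : first_row_ones H.

(** Orthogonality to the all-one row says that the entries of row [i] sum to 0, that is, 2 |B| - n =
    0 for the block B. *)
Lemma card_row_block s (i : 'I_n) :
  (0 < i)%N -> (#|row_block (s, i)| * 2)%N = n.
Proof.
move=> i_gt0; have n_gt0 : (0 < n)%N by apply: leq_ltn_trans (ltn_ord i).
have := hadamard_dot_row i (Ordinal n_gt0).
rewrite -val_eqE /= eqn0Ngt i_gt0 /= mulr0n.
under eq_bigr => j _ do
  rewrite (@H_first_row (Ordinal n_gt0)) // mulr1 (row_blockE s).
rewrite -mulr_sumr sumrB sumr_const card_ord sumrMnl -natr_sum.
have -> : (\sum_j (j \in row_block (s, i)) = #|row_block (s, i)|)%N.
  by rewrite -sum1_card [RHS]big_mkcond; apply: eq_bigr => j _; case: ifP.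
by move=> /eqP; rewrite mulf_eq0 signr_eq0 /=; lia.
Qed.

(* For signs [a, b, c], [1 + a b + a c + b c] is 4 if [a = b = c] and 0
   otherwise; the row index 0 contributes one triple. *)
Lemma sum_triple_block (x y z : 'I_n) : x != y -> x != z -> y != z ->
  (4 * #|[set B in hadamard_design H | [set x; y; z] \subset B]| + 4)%N = n.
Proof.
move=> xy xz yz; have n_gt0 : (0 < n)%N by apply: leq_ltn_trans (ltn_ord x).
pose i0 := Ordinal n_gt0.
(* Number, 0 or 1, of blocks of row [i] that contain all three points. *)
pose mono (i : 'I_n) : nat :=
  (\sum_(s : bool) ([set x; y; z] \subset row_block (s, i)))%N.
have mono4 i :
    (4 * mono i)%:R = 1 + H i x * H i y + H i x * H i z + H i y * H i z.
  rewrite /mono big_bool /= !subUset !sub1set !inE /=.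
  by case/orP: (hadamard_entry i x) => /eqP ->;
     case/orP: (hadamard_entry i y) => /eqP ->;
     case/orP: (hadamard_entry i z) => /eqP ->.
(* Column orthogonality kills the three sums of products, leaving the sum of the ones. *)
have sum_mono : (4 * \sum_i mono i)%N = n.
  apply/eqP; rewrite -(eqr_nat int) big_distrr /= natr_sum.
  under eq_bigr => i _ do rewrite mono4.
  rewrite !big_split /= !hadamard_dot_col (negPf xy) (negPf xz) (negPf yz).
  by rewrite sumr_const card_ord !mulr0n !addr0.
have mono0 : mono i0 = 1%N.
  by have := mono4 i0; rewrite !H_first_row //; lia.
have -> : #|[set B in hadamard_design H | [set x; y; z] \subset B]|
    = (\sum_(i | i != i0) mono i)%N.
  (* Both sides become sums over pairs of a sign and a nonzero row index, by injectivity of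
     [row_block]. *)
  rewrite exchange_big /= pair_big_dep /= -sum1dep_card hadamard_designE.
  rewrite big_mkcondr big_imset /=; last first.
    by move=> p p' _ _; apply: row_block_inj.
  apply: eq_big => [[s i]|[s i] _] /=; last by case: ifP.
  by rewrite inE -val_eqE /= lt0n.
by move: sum_mono; rewrite (bigD1 i0) //= mono0; lia.
Qed.

Lemma hadamard_is_design t : n = (4 * t)%N ->
  is_design 3 (4 * t) (2 * t) t.-1 (hadamard_design H).
Proof.
move=> n4t; split; first by rewrite card_ord.
  rewrite hadamard_designE => B /imsetP[[s i]]; rewrite inE /= => i_gt0 ->.
  by rewrite -[#|_|](@mulnK _ 2) // (card_row_block s i_gt0); lia.
move=> X /cards3_decomp[x [y [z [xy xz yz ->]]]].
by move: (sum_triple_block xy xz yz); set m := #|_|; lia.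
Qed.

End HadamardDesign.

(** * Reduction modulo 3, codes, and integral orthogonal matrices *)

Lemma mod3M m n p (A : 'M[int]_(m, n)) (B : 'M[int]_(n, p)) :
  mod3 (A *m B) = mod3 A *m mod3 B.
Proof. exact: (map_mxM intr). Qed.

Lemma code_of_closed m n (G : 'M['F_3]_(m, n)) (a b : 'F_3)
    (c d : 'rV['F_3]_n) :
  c \in code_of G -> d \in code_of G -> a *: c + b *: d \in code_of G.
Proof. by rewrite !inE => cG dG; rewrite addmx_sub ?scalemx_sub. Qed.

Lemma int_unit_row n (a : 'I_n -> int) : \sum_j a j * a j = 1 ->
  (forall j, a j \in [:: 0; 1; -1]) /\ #|[set j | a j != 0]| = 1%N.
Proof.
move=> a1.
have entry j : a j \in [:: 0; 1; -1].
  have : a j * a j <= 1.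
    rewrite -a1 (bigD1 j) //= lerDl sumr_ge0 // => k _.
    by rewrite -expr2 sqr_ge0.
  by rewrite !inE; nia.
split=> //; apply/eqP; rewrite -(eqr_nat int) -[eqbRHS]a1 -sum1_card natr_sum.
rewrite big_mkcond /=; apply/eqP/eq_bigr => j _; rewrite inE.
by move: (entry j); rewrite !inE => /or3P[] /eqP ->.
Qed.

(** Rows and, because a right inverse is also a left inverse, columns are integer vectors of norm
    1. *)
Lemma orthogonal_monomial n (A : 'M[int]_n) : A *m A^T = 1%:M -> is_monomial A.
Proof.
move=> AAt.
have row_unit i : \sum_j A i j * A i j = 1.
  move/matrixP/(_ i i): AAt; rewrite !mxE eqxx => A1.
  rewrite -[RHS]A1.
  by apply: eq_bigr => j _; rewrite mxE.
have col_unit j : \sum_i A i j * A i j = 1.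
  move/matrixP/(_ j j): (mulmx1C AAt); rewrite !mxE eqxx => A1.
  rewrite -[RHS]A1.
  by apply: eq_bigr => i _; rewrite mxE.
split=> [i j|i|j].
- by have [] := int_unit_row (row_unit i).
- by have [] := int_unit_row (row_unit i).
- by have [] := int_unit_row (col_unit j).
Qed.

(** * Properties of the matrix [H_mx] *)

Section HadamardMatrix.

Variable F : finFieldType.
Hypothesis q_odd : odd #|F|.

Lemma H_mx_hadamard : is_hadamard (H_mx F).
Proof.
split.
  rewrite /H_mx.
  (* Abstracting [U_mx F] keeps [mxE] from unfolding its entries. *)
  move: (U_mx F) (@U_mx_diag F) (@U_mx_off F) => V V_diag V_off i j.
  have Vt_off k l : k != l -> V l k = 1 \/ V l k = -1.
    by rewrite eq_sym; apply: V_off.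
  rewrite -(splitK i) -(splitK j).
  case: (split i) (split j) => [i'|i'] [j'|j'];
    rewrite /= ?block_mxEul ?block_mxEur ?block_mxEdl ?block_mxEdr !mxE;
    case: (eqVneq i' j') => [->|ij]; rewrite ?V_diag //;
    by [case: (V_off _ _ ij) => -> | case: (Vt_off _ _ ij) => ->].
have UUt := U_mx_mul_tr q_odd; have UtU := U_mx_tr_mul q_odd.
rewrite /H_mx tr_block_mx !linearD /= !linearN /= !trmx1 trmxK mulmx_block.
(* Both U U^T and U^T U occur in every block: they add up in the diagonal blocks and cancel in the
   others. *)
rewrite !(mulmxDl, mulmxDr, mulmxN, mulNmx, mul1mx, mulmx1) !UUt !UtU.
rewrite scalar_mx_block; move: (U_mx F) {UUt UtU} => V.
by congr block_mx; apply/matrixP=> i j; rewrite !mxE ?natrD -?natr1;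
  case: (i == j); rewrite ?mulr1n ?mulr0n; ring.
Qed.

(** The column of infinity in U is -1 off the diagonal, so the first row of I - U^T is all-one; the
    first row of U + I is so directly. *)
Lemma H_mx_first_row : first_row_ones (H_mx F).
Proof.
move=> i j i0.
have -> : i = lshift _ ord0 by apply: val_inj.
rewrite /H_mx; move: (U_mx F) (@U_mx_row0 F) (@U_mx_col0 F) => V V_row V_col.
rewrite -(splitK j); case: (split j) => k;
  rewrite /= ?block_mxEul ?block_mxEur !mxE ?V_row ?V_col [ord0 == _]eq_sym;
  by case: eqP.
Qed.

Lemma H_mx_L_code i : #|F| = 2 %[mod 3] -> row i (mod3 (H_mx F)) \in L_code F.
Proof.
move=> q_mod3; rewrite inE.
have UtU : (mod3 (U_mx F))^T *m mod3 (U_mx F) = - 1%:M.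
  rewrite /mod3 map_trmx -/(mod3 _) -mod3M U_mx_tr_mul //.
  rewrite /mod3 map_scalar_mx /=.
  have -> : (#|F|%:R : int)%:~R = -1 :> 'F_3.
    rewrite rmorph_nat (divn_eq #|F| 3) q_mod3 natrD natrM.
    by rewrite (_ : 3%:R = 0 :> 'F_3) ?mulr0 ?add0r; apply: val_inj.
  by rewrite -[RHS]scaleN1r scalemx1.
(* With U^T U = -I, (I - U^T) U = U + I and (I + U^T) U = U - I. *)
have -> : mod3 (H_mx F) =
    col_mx (1%:M - (mod3 (U_mx F))^T) (1%:M + (mod3 (U_mx F))^T)
      *m row_mx 1%:M (mod3 (U_mx F)).
  rewrite mul_col_row !mulmx1 !(mulmxDl, mulNmx, mul1mx) UtU.
  rewrite opprK /H_mx /mod3 map_block_mx; move: (U_mx F) => V.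
  by congr block_mx; apply/matrixP=> a b;
    rewrite !mxE ?rmorphD /= ?rmorphN /= ?rmorph_nat.
by rewrite row_mul submxMl.
Qed.

Lemma H_mx_equiv : hadamard_equiv (H_mx F) (paley_hadamard_II F).
Proof.
rewrite /paley_hadamard_II -(is_squareN1 q_odd).
have [sq|nsq] := boolP (is_square (-1 : F)); last first.
  have St : (S_mx F)^T = - S_mx F by rewrite (tr_S_mx q_odd) ifN // scaleN1r.
  have monomial1 : is_monomial (1%:M : 'M_(#|F|.+1 + #|F|.+1)).
    by apply: orthogonal_monomial; rewrite trmx1 mulmx1.
  exists 1%:M, 1%:M; split=> //.
  rewrite mul1mx mulmx1 /H_mx U_mx_nonsquare // St opprK.
  by congr block_mx; rewrite // addrC.
have St : (S_mx F)^T = S_mx F by rewrite (tr_S_mx q_odd) ifT // scale1r.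
pose P := infty_proj F; pose D := infty_flip F.
(* The left factor keeps the upper infinity row and negates the lower one; each other lower row
   moves up, and each other upper row moves down negated. *)
exists (block_mx P (1%:M - P) (P - 1%:M) (- P)), (block_mx 1%:M 0 0 D).
have Pt : P^T = P by rewrite trmx_delta.
have Dt : D^T = D by apply: tr_infty_flip.
have PP : P *m P = P := infty_projK F.
have DD : D *m D = 1%:M := infty_flipK F.
have PD : P *m D = - P by rewrite !mulmxBr mulmx1 PP subrr sub0r.
split.
- apply: orthogonal_monomial.
  rewrite tr_block_mx mulmx_block !linearB /= !linearN /= trmx1 Pt.
  rewrite !(mulmxBl, mulmxBr, mul1mx, mulmx1, mulNmx, mulmxN) PP !subrr.
  rewrite scalar_mx_block; clearbody P.
  by congr block_mx; apply/matrixP=> a b; rewrite !mxE; ring.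
- apply: orthogonal_monomial.
  rewrite tr_block_mx mulmx_block !trmx0 trmx1 Dt !mulmx0 !mul0mx mulmx1 DD.
  by rewrite !addr0 add0r -scalar_mx_block.
have DE : D = 1%:M - P - P by [].
rewrite /H_mx /paley_hadamard_H1 U_mx_square // trmx_mul tr_infty_flip St -/D.
move: (S_mx F) => S; clearbody P D.
rewrite !mulmx_block !mulmx0 !mulmx1 !addr0 !add0r.
rewrite !(mulmxBl, mulmxDl, mulmxBr, mulmxDr, mul1mx, mulmx1, mulNmx,
  mulmxN, mulmxA).
rewrite -!(mulmxA _ D D) DD !mulmx1 PD.
(* All blocks are now linear in I, P, S and P S, so the identity can be checked entrywise. *)
rewrite DE !(mulmxBl, mul1mx, mulNmx); move: (P *m S) => PS.
by congr block_mx; apply/matrixP=> a b; rewrite !mxE; ring.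
Qed.

End HadamardMatrix.

(** * Codewords from the blocks of the design *)

Unset Implicit Arguments.

Theorem theorem1 (q : nat) (F : finFieldType) (cardF : #|F| = q)
    (q_odd : odd q) (q_mod3 : q = 2 %[mod 3]) :
  let H := H_mx F in
  let D := hadamard_design H in
  [/\ is_hadamard H,
      first_row_ones H,
      forall i, row i (mod3 H) \in L_code F
    & hadamard_equiv H (paley_hadamard_II F)] /\
  is_design 3 (2 * q + 2) (q + 1) ((q - 1) %/ 2) D /\
  exists C : {set 'rV['F_3]_(#|F|.+1 + #|F|.+1)},
    [/\ C \subset L_code F,
        #|C| = (4 * q + 2)%N,
        forall c, c \in C -> forall j, c 0 j \in [:: 0; 1],
        forall c, c \in C -> hamming_weight c = (q + 1)%N
      & exists M : 'M['F_3]_((4 * q + 2)%N, #|F|.+1 + #|F|.+1),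
          C = [set row i M | i : 'I_(4 * q + 2)] /\ is_incidence_matrix M D].
Proof.
move=> H D; rewrite -cardF in q_odd q_mod3.
have H_had : is_hadamard H := H_mx_hadamard q_odd.
have H_ones : first_row_ones H := @H_mx_first_row F.
have H_code i : row i (mod3 H) \in L_code F := H_mx_L_code q_odd i q_mod3.
have rowE i j : (row i (mod3 H)) 0 j = (H i j)%:~R by rewrite 2!mxE.
split; first by split=> //; apply: H_mx_equiv.
have D_design : is_design 3 (2 * q + 2) (q + 1) ((q - 1) %/ 2) D.
  (* The order 2q + 2 is 4t with t = (q + 1)/2, an integer since q is odd. *)
  have := hadamard_is_design H_had H_ones (t := (q.+1)./2).
  have -> : (4 * q.+1./2 = 2 * q + 2)%N by lia.
  have -> : (2 * q.+1./2 = q + 1)%N by lia.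
  have -> : (q.+1./2.-1 = (q - 1) %/ 2)%N by lia.
  by apply; lia.
split=> //; have [_ D_size _] := D_design.
have cardD : #|D| = (4 * q + 2)%N.
  by rewrite card_hadamard_design //; lia.
pose e (i : 'I_(4 * q + 2)) : {set 'I_(#|F|.+1 + #|F|.+1)} :=
  enum_val (cast_ord (esym cardD) i).
have eD i : e i \in D by apply: enum_valP.
have e_inj : injective e by move=> i j /enum_val_inj /cast_ord_inj.
pose M : 'M['F_3]_(4 * q + 2, #|F|.+1 + #|F|.+1) :=
  \matrix_(i, j) (j \in e i)%:R.
have ME i j : (row i M) 0 j = (j \in e i)%:R by rewrite !mxE.
exists [set row i M | i : 'I_(4 * q + 2)]; split.
- apply/subsetP=> _ /imsetP[i _ ->].
  have := eD i; rewrite /D hadamard_designE => /imsetP[[s k] _ e_i].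
  (* Row 0 of [H] supplies the all-one vector; modulo 3, -(1 + 1) = 1 on the block and -(1 - 1) = 0
     off it. *)
  have -> : row i M =
      (-1) *: row ord0 (mod3 H) + (- (-1) ^+ s) *: row k (mod3 H).
    apply/rowP=> j; rewrite ME e_i mxE [X in X + _]mxE [X in _ + X]mxE.
    rewrite !rowE H_ones // (row_blockE H_had s k j).
    by case: (j \in _); case: s {e_i}; apply/val_inj.
  exact: code_of_closed.
- rewrite card_imset ?card_ord // => i k ik; apply: e_inj.
  apply/setP=> j; have := congr1 (fun c : 'rV_ _ => c 0 j) ik; rewrite /= !ME.
  by case: (j \in e i); case: (j \in e k).
- by move=> _ /imsetP[i _ ->] j; rewrite ME; case: (j \in e i).
- move=> _ /imsetP[i _ ->]; rewrite -(D_size _ (eD i)) /hamming_weight.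
  by apply: eq_card => j; rewrite inE ME; case: (j \in e i).
- exists M; split=> //; exists e; split=> // [|i j]; last by rewrite !mxE.
  apply/setP=> B; apply/imsetP/idP => [[i _ ->]|BD].
    exact: eD.
  exists (cast_ord cardD (enum_rank_in BD B)) => //.
  by rewrite /e cast_ordK enum_rankK_in.
Qed.
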